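(* For every positive integer $n$, $$\sum_{k=0}^{n}\binom{n}{k}\left(\sqrt{y^2+4t}\right)^{n-k-1}\left(2^kL_k(y,t)-2y^k\right)B_{n-k}(x)=n\left(y+\sqrt{y^2+4t}\,x\right)^{n-1}-n\left(y+(x-1)\sqrt{y^2+4t}\right)^{n-1}.$$
   Context: Here $x,y,t$ are commuting variables (indeterminates) and $\sqrt{y^2+4t}$ denotes a fixed square root of $y^2+4t$ (in an extension field of the field of rational functions in $x,y,t$). The bivariate Lucas polynomials are defined by $L_0(y,t)=2$, $L_1(y,t)=y$, $L_n(y,t)=yL_{n-1}(y,t)+tL_{n-2}(y,t)$ for $n\ge 2$. The Bernoulli polynomials $B_n(x)$ are defined by $\sum_{n\ge 0}B_n(x)\frac{z^n}{n!}=\frac{ze^{xz}}{e^z-1}$. *)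

(* Defs.v *)
From mathcomp Require Import all_boot all_order all_algebra.
From mathcomp Require Export fraction mpoly.

Set Implicit Arguments.
Unset Strict Implicit.
Unset Printing Implicit Defensive.

Import GRing.Theory.
Local Open Scope ring_scope.

Fixpoint lucas (R : comNzRingType) (y t : R) (n : nat) : R :=
  match n with
  | 0 => 2
  | 1 => y
  | (m.+1 as k).+1 => y * lucas y t k + t * lucas y t m
  end.

(* Formal power series in z over R, given by their coefficient sequences. *)
Definition fps (R : Type) := nat -> R.

Definition fps_const (R : comNzRingType) (c : R) : fps R :=
  fun n => if n == 0%N then c else 0.

Definition fps_z (R : comNzRingType) : fps R := fun n => (n == 1%N)%:R.

Definition fps_sub (R : comNzRingType) (f g : fps R) : fps R :=
  fun n => f n - g n.

Definition fps_mul (R : comNzRingType) (f g : fps R) : fps R :=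
  fun n => \sum_(i < n.+1) f i * g (n - i)%N.

(* The exponential generating series of a, and e^(p z) for p in Q[x]. *)
Definition egf (a : nat -> {poly rat}) : fps {poly rat} :=
  fun n => (n`!%:R)^-1 *: a n.

Definition fps_exp (p : {poly rat}) : fps {poly rat} :=
  egf (fun n => p ^+ n).

(* The defining equation of the Bernoulli polynomials, with the denominator
   e^z - 1 multiplied out: it has no constant term, hence is not invertible
   in Q[x][[z]], but it is not a zero divisor.  By [bernoulli_exists] and
   [bernoulli_unique] below, exactly one sequence satisfies it. *)
Definition is_bernoulli (B : nat -> {poly rat}) : Prop :=
  fps_mul (egf B) (fps_sub (fps_exp 1) (fps_const 1))
    =1 fps_mul (fps_z {poly rat}) (fps_exp 'X).

Lemma is_bernoulliE B :
  is_bernoulli B <->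
  forall n, egf B n =
    fps_exp 'X n - \sum_(i < n) egf B i * ((n.+1 - i)`!%:R^-1)%:P.
Proof.
have d0 : fps_sub (fps_exp 1) (fps_const 1) 0 = 0.
  by rewrite /fps_sub /fps_exp /egf /fps_const /= fact0 invr1 scale1r subrr.
have dS n : fps_sub (fps_exp 1) (fps_const 1) n.+1 = (n.+1`!%:R^-1)%:P.
  by rewrite /fps_sub /fps_exp /egf /fps_const /= expr1n subr0 alg_polyC.
have lhs n : fps_mul (egf B) (fps_sub (fps_exp 1) (fps_const 1)) n.+1 =
    \sum_(i < n) egf B i * ((n.+1 - i)`!%:R^-1)%:P + egf B n.
  rewrite /fps_mul big_ord_recr /= subnn d0 mulr0 addr0.
  rewrite big_ord_recr /= subSnn dS (_ : 1`! = 1)%N // invr1 mulr1; congr (_ + _).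
  by apply: eq_bigr => i _; rewrite subSn ?dS // ltnW.
have rhs n : fps_mul (fps_z {poly rat}) (fps_exp 'X) n.+1 = fps_exp 'X n.
  rewrite /fps_mul /fps_z big_ord_recl mul0r add0r big_ord_recl mul1r.
  by rewrite big1 ?addr0 ?subSS ?subn0 // => i _; rewrite mul0r.
split=> [h n | h [|n]].
- by have := h n.+1; rewrite lhs rhs => <-; rewrite addrC addKr.
- by rewrite /fps_mul !big_ord_recl !big_ord0 subnn d0 mulr0 mul0r.
- by rewrite lhs rhs addrC h subrK.
Qed.

Lemma bernoulli_exists : exists B, is_bernoulli B.
Proof.
pose next (s : seq {poly rat}) := let n := size s in
  fps_exp 'X n - \sum_(i < n) s`_i * ((n.+1 - i)`!%:R^-1)%:P.
pose pre n := iter n (fun s => rcons s (next s)) [::].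
have sz n : size (pre n) = n by elim: n => //= n IH; rewrite size_rcons IH.
pose b n := next (pre n).
have preE n i : (i < n)%N -> (pre n)`_i = b i.
  elim: n => // n IH; rewrite ltnS leq_eqVlt /= nth_rcons sz.
  by case/predU1P => [-> | lin]; rewrite ?ltnn ?eqxx // lin IH.
exists (fun n => n`!%:R *: b n).
have eb n : egf (fun n => n`!%:R *: b n) n = b n.
  rewrite /egf scalerA mulVf ?scale1r //.
  by rewrite Num.Theory.pnatr_eq0 -lt0n fact_gt0.
apply/is_bernoulliE => n; rewrite eb {1}/b /next sz; congr (_ - _).
by apply: eq_bigr => i _; rewrite eb preE.
Qed.

Lemma bernoulli_unique B C : is_bernoulli B -> is_bernoulli C -> B =1 C.
Proof.
move=> /is_bernoulliE hB /is_bernoulliE hC n.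
have: egf B n = egf C n.
  elim/ltn_ind: n => n IH; rewrite hB hC; congr (_ - _).
  by apply: eq_bigr => i _; rewrite IH.
apply: scalerI; rewrite invr_eq0.
by rewrite Num.Theory.pnatr_eq0 -lt0n fact_gt0.
Qed.

(* The indeterminates x, y, t of Q[x, y, t]. *)
Definition Xx : {mpoly rat[3]} := 'X_(@Ordinal 3 0 isT).
Definition Xy : {mpoly rat[3]} := 'X_(@Ordinal 3 1 isT).
Definition Xt : {mpoly rat[3]} := 'X_(@Ordinal 3 2 isT).

(* An extension field of Q(x, y, t) is a field L with a (necessarily
   injective) ring morphism iota from Q(x, y, t); [emb iota] is the induced
   embedding of Q[x, y, t] in L. *)
Definition emb (L : fieldType) (iota : {rmorphism {fraction {mpoly rat[3]}} -> L})
  (p : {mpoly rat[3]}) : L := iota (tofrac p).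

(* Main.v *)
(* With s = sqrt(y^2 + 4t), Binet's formula reads
   2^k L_k = (y + s)^k + (y - s)^k, so that 2^k L_k - 2 y^k is the difference
   of (c + s)^k - c^k at c = y and at c = y - s.  Since
   sum_(j < m) C(m, j) B_j(x) = m x^(m-1), convolving s^j B_j(x) with
   (c + s)^k - c^k gives n s (c + s x)^(n-1), for every c.  It remains to divide
   by s, which is nonzero as y^2 + 4t is. *)
Require Import Defs.
From mathcomp Require Import all_boot all_order all_algebra.
From mathcomp Require Import ring zify.

Import GRing.Theory.
Local Open Scope ring_scope.

(** Both sides are the multinomial coefficient n! / (i! j! (n-i-j)!). *)
Lemma mul_bin_trinomial n i j : (i + j <= n)%N ->
  ('C(n, j) * 'C(n - j, i) = 'C(n, i) * 'C(n - i, j))%N.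
Proof.
move=> le_ijn; have [le_in le_jn] : (i <= n /\ j <= n)%N by lia.
apply/eqP; rewrite -(eqn_pmul2r (fact_gt0 j)) -(eqn_pmul2r (fact_gt0 i)).
rewrite -(eqn_pmul2r (fact_gt0 (n - j - i))); apply/eqP.
have h1 := bin_fact le_jn; have h2 := bin_fact le_in.
have h3 : (i <= n - j)%N by lia.
have h4 : (j <= n - i)%N by lia.
move: (bin_fact h3) (bin_fact h4); rewrite (subnAC n i j) => h5 h6.
transitivity n`!%N; first by rewrite -h1 -h5; ring.
by rewrite -h2 -h6; ring.
Qed.

(** Subtracting c^m removes the top term of the binomial expansion. The range is padded to a fixed
    [n] so that sums with varying [m] can be exchanged. *)
Lemma exprD_sub_pow (R : comNzRingType) (c s : R) m n : (m <= n)%N ->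
  (c + s) ^+ m - c ^+ m
    = \sum_(i < n | (i < m)%N) 'C(m, i)%:R * c ^+ i * s ^+ (m - i).
Proof.
move=> le_mn; rewrite addrC (addrC c s) exprDn big_ord_recr /= subnn expr0 mul1r.
rewrite binn mulr1n addrC addrK.
rewrite (big_ord_widen n (fun i => s ^+ (m - i) * c ^+ i *+ 'C(m, i))) //.
by apply: eq_bigr => i _; rewrite -mulr_natl; ring.
Qed.

Lemma bernoulli_convolution (R : comNzRingType) (b : nat -> R) (x : R) :
  (forall m, \sum_(j < m) 'C(m, j)%:R * b j = m%:R * x ^+ m.-1) ->
  forall (c s : R) n,
    \sum_(j < n.+1) 'C(n, j)%:R * s ^+ j * b j * ((c + s) ^+ (n - j) - c ^+ (n - j))
    = n%:R * s * (c + s * x) ^+ n.-1.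
Proof.
move=> hb c s n.
under eq_bigr => j _ do rewrite (@exprD_sub_pow _ _ _ _ n (leq_subr j n)) mulr_sumr.
rewrite (exchange_big_dep xpredT) //=.
have inner (i : 'I_n) :
  \sum_(j < n.+1 | (i < n - j)%N)
     'C(n, j)%:R * s ^+ j * b j * ('C(n - j, i)%:R * c ^+ i * s ^+ (n - j - i))
  = n%:R * s * ('C(n.-1, i)%:R * c ^+ i * (s * x) ^+ (n.-1 - i)).
  have lt_in := ltn_ord i.
  (* The powers of s combine to s^(n-i), free of j, and the trinomial identity pulls C(n, i) out;
     what remains is the hypothesis at m = n - i. *)
  transitivity ('C(n, i)%:R * c ^+ i * s ^+ (n - i)
                * \sum_(j < n - i) 'C(n - i, j)%:R * b j).
    rewrite (big_ord_widen n.+1 (fun j => 'C(n - i, j)%:R * b j)); last by lia.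
    rewrite mulr_sumr; apply: eq_big => [j|j lt_ij]; first by lia.
    have -> : (n - i = j + (n - j - i))%N by lia.
    rewrite exprD.
    have -> : (j + (n - j - i) = n - i)%N by lia.
    have /(congr1 (fun k => k%:R : R)) := @mul_bin_trinomial n i j ltac:(lia).
    rewrite !natrM => E.
    transitivity ('C(n, j)%:R * 'C(n - j, i)%:R * (s ^+ j * b j * (c ^+ i * s ^+ (n - j - i)))).
      by ring.
    by rewrite E; ring.
  rewrite hb.
  have /(congr1 (fun k => k%:R : R)) : ('C(n, i) * (n - i) = n * 'C(n.-1, i))%N.
    by rewrite mul_bin_down mulnC.
  rewrite !natrM => E.
  have -> : ((n - i).-1 = n.-1 - i)%N by lia.
  have -> : (n - i = (n.-1 - i).+1)%N by lia.
  rewrite exprMn exprS.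
  have -> : ((n.-1 - i).+1 = n - i)%N by lia.
  transitivity ('C(n, i)%:R * (n - i)%:R * (c ^+ i * (s * s ^+ (n.-1 - i)) * x ^+ (n.-1 - i))).
    by ring.
  by rewrite E; ring.
under eq_bigr => i _ do rewrite inner.
rewrite -mulr_sumr.
(* For positive n the sum over i < n is the full binomial expansion of (c + s x)^(n-1). *)
case: n {inner} => [|n]; first by rewrite big_ord0 !mul0r.
congr (_ * _); rewrite /= (addrC c) exprDn; apply: eq_bigr => i _.
by rewrite -mulr_natl; ring.
Qed.

(** For m > 0, this is m! times the coefficient of z^m in the defining equation; the term j = m
    drops out since e^z - 1 has no constant term. *)
Lemma bernoulli_sum B : is_bernoulli B ->
  forall m, \sum_(j < m) 'C(m, j)%:R * B j = m%:R * 'X ^+ m.-1.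
Proof.
move=> hB [|m]; first by rewrite big_ord0 mul0r.
have fact_neq0 k : k`!%:R != 0 :> rat.
  by rewrite Num.Theory.pnatr_eq0 -lt0n fact_gt0.
have natC k : k%:R = (k%:R)%:P :> {poly rat} by rewrite polyC_natr.
have const0 : fps_sub (fps_exp 1) (fps_const 1) 0 = 0.
  by rewrite /fps_sub /fps_exp /egf /fps_const /= fact0 invr1 scale1r subrr.
have rhs : fps_mul (fps_z {poly rat}) (fps_exp 'X) m.+1 = fps_exp 'X m.
  rewrite /fps_mul /fps_z big_ord_recl mul0r add0r big_ord_recl mul1r.
  by rewrite big1 ?addr0 ?subSS ?subn0 // => i _; rewrite mul0r.
have := congr1 (fun p => m.+1`!%:R *: p) (hB m.+1).
rewrite /= rhs /fps_mul big_ord_recr /= subnn const0 mulr0 addr0 scaler_sumr.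
rewrite /fps_exp /egf scalerA factS natrM mulfK // => E.
rewrite natC mul_polyC -E; apply: eq_bigr => i _.
have lt_im := ltn_ord i.
rewrite /fps_sub /fps_const subn_eq0 leqNgt lt_im /= subr0 expr1n.
rewrite natC mul_polyC alg_polyC [_ * _%:P]mulrC mul_polyC !scalerA; congr (_ *: _).
have /(congr1 (fun k => k%:R : rat)) := bin_fact (ltnW lt_im).
rewrite factS !natrM => <-.
by rewrite -mulrA -[in RHS]mulrA; field; rewrite !fact_neq0.
Qed.

(** Both sides satisfy u_(k+2) = 2y u_(k+1) + 4t u_k, because 4t = s^2 - y^2; the factor 2^k avoids
    halving y + s and y - s. *)
Lemma lucas_binet (R : comNzRingType) (y t s : R) k : s ^+ 2 = y ^+ 2 + 4 * t ->
  2 ^+ k * lucas y t k = (y + s) ^+ k + (y - s) ^+ k.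
Proof.
move=> hs; elim/ltn_ind: k => -[|[|k]] IH; first by rewrite /= !expr0; ring.
  by rewrite /= !expr1; ring.
have IH1 := IH k.+1 ltac:(lia); have IH0 := IH k ltac:(lia).
have -> : 2 ^+ k.+2 * lucas y t k.+2
  = 2 * y * (2 ^+ k.+1 * lucas y t k.+1) + 4 * t * (2 ^+ k * lucas y t k).
  have -> : lucas y t k.+2 = y * lucas y t k.+1 + t * lucas y t k by [].
  by rewrite !exprS; ring.
have -> : 4 * t = s ^+ 2 - y ^+ 2 by rewrite hs; ring.
by rewrite IH1 IH0 !exprS; ring.
Qed.

Lemma discriminant_neq0 : Xy ^+ 2 + 4 * Xt != 0.
Proof.
(* At x = 0, y = 1, t = 0 the value is 1. *)
apply/eqP => /(congr1 (meval (fun i : 'I_3 => (i == 1 :> nat)%:R))) /eqP.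
rewrite expr2 mevalD !mevalM !mevalXU -mpolyC_nat mevalC meval0.
by [].
Qed.

Theorem corollary20
    (L : fieldType) (iota : {rmorphism {fraction {mpoly rat[3]}} -> L})
    (s : L) (hs : s ^+ 2 = emb iota (Xy ^+ 2 + 4 * Xt))
    (B : nat -> {poly rat}) (hB : is_bernoulli B)
    (n : nat) (hn : (0 < n)%N) :
  let x := emb iota Xx in
  let y := emb iota Xy in
  let t := emb iota Xt in
  \sum_(k < n.+1)
     'C(n, k)%:R * s ^ (n%:Z - k%:Z - 1)
       * (2 ^+ k * lucas y t k - 2 * y ^+ k)
       * emb iota (horner_alg Xx (B (n - k)%N))
  = n%:R * (y + s * x) ^+ (n - 1) - n%:R * (y + (x - 1) * s) ^+ (n - 1).
Proof.
move=> x y t.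
have s_neq0 : s != 0.
  rewrite -sqrf_eq0 hs /emb fmorph_eq0 tofrac_eq0; exact: discriminant_neq0.
have hs' : s ^+ 2 = y ^+ 2 + 4 * t.
  by rewrite hs /emb 2!rmorphD 2!rmorphXn 2!rmorphM !rmorph_nat.
(* Evaluation at x as a ring morphism carries [bernoulli_sum] over to [L]. *)
pose ev : {rmorphism {poly rat} -> L} := iota \o @tofrac _ \o horner_alg Xx.
pose b j := ev (B j).
have hb m : \sum_(j < m) 'C(m, j)%:R * b j = m%:R * x ^+ m.-1.
  have := congr1 ev (bernoulli_sum B hB m).
  rewrite rmorph_sum rmorphM rmorphXn rmorph_nat.
  have -> : ev 'X = x by rewrite /= horner_algX.
  by move=> <-; apply: eq_bigr => j _; rewrite rmorphM rmorph_nat.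
have conv := bernoulli_convolution _ _ _ hb.
(* Set j = n - k, the index of the Bernoulli polynomial. *)
apply: (mulfI s_neq0); rewrite mulr_sumr (reindex_inj rev_ord_inj) /=.
rewrite subn1.
have -> : s * (n%:R * (y + s * x) ^+ n.-1 - n%:R * (y + (x - 1) * s) ^+ n.-1)
  = n%:R * s * (y + s * x) ^+ n.-1 - n%:R * s * (y - s + s * x) ^+ n.-1.
  have -> : y + (x - 1) * s = y - s + s * x by ring.
  by ring.
rewrite -!conv -sumrB; apply: eq_bigr => j _.
have le_jn : (j <= n)%N by rewrite -ltnS.
(* For c = y - s, c + s is y, so the two differences add 2 y^k. *)
rewrite subSS subKn // bin_sub // (lucas_binet _ _ _ _ _ hs') subrK.
have -> : n%:Z - (n - j)%N%:Z - 1 = j%:Z - 1 by lia.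
(* The exponent j - 1 is -1 at j = 0; the extra factor s cancels s^(-1). *)
rewrite expfzDr // exprN1 -exprnP.
by field.
Qed.
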